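(* Let $\tau:\mathbb{R}\to(0,+\infty)$ be continuous with $\limsup_{t\to-\infty}\tau(t)<+\infty$. Let $\kappa>0$ and let $G:[0,+\infty)\to[0,+\infty)$ be continuous with $G(0)=0$, $G(s)>s$ for $s\in(0,\kappa)$, and $$\lim_{s\to+\infty}\frac{q_0(s)}{s}=0,\qquad\text{where } q_0(s)=\max\{G(x):x\in[0,s]\}.$$ Then, for each $t_0\in\mathbb{R}$ and $c\in(0,\kappa e^{-M_\tau}]$, where $M_\tau=\sup\{\tau(t):t\le t_0\}$, there exists a positive global solution $u$ to $$u'(t)=-u(t)+G(u(t-\tau(t))),\qquad t\in\mathbb{R},$$ such that $u(t_0)=c$, $u(t)\le\kappa$ for $t\le t_0$, and there exists a limit $u(-\infty)=0$.
   Context: A global solution is a function $u:\mathbb{R}\to\mathbb{R}$ absolutely continuous on every compact interval and satisfying the equation for a.e. $t\in\mathbb{R}$; it is positive if $u(t)>0$ for all $t\in\mathbb{R}$. $u(-\infty)$ denotes the limit of $u$ at $-\infty$. *)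

(* Defs.v *)
From HB Require Import structures.
From mathcomp Require Import all_boot all_order all_algebra.
From mathcomp Require Import all_classical all_reals all_analysis.

Set Implicit Arguments.
Unset Strict Implicit.
Unset Printing Implicit Defensive.

Import Order.TTheory GRing.Theory Num.Theory.
Import numFieldNormedType.Exports.

Local Open Scope classical_set_scope.
Local Open Scope ring_scope.

(* The epsilon-delta definition over finite families of nonoverlapping
   subintervals; degenerate intervals are harmless. *)
Definition abs_continuous_on (R : realType) (a b : R) (f : R -> R) : Prop :=
  forall e : R, 0 < e -> exists2 d : R, 0 < d &
    forall (n : nat) (x y : 'I_n -> R),
      (forall i, a <= x i /\ x i <= y i /\ y i <= b) ->
      (forall i j, i != j -> `]x i, y i[ `&` `]x j, y j[ = set0) ->
      \sum_(i < n) (y i - x i) < d ->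
      \sum_(i < n) `|f (y i) - f (x i)| < e.

(* G only matters on [0, +oo[; the value of a total G at negative arguments
   plays no role for positive u. *)
Definition global_solution (R : realType) (tau G u : R -> R) : Prop :=
  (forall a b : R, a <= b -> abs_continuous_on a b u) /\
  {ae @lebesgue_measure R, forall t : R,
     is_derive t 1 u (- u t + G (u (t - tau t)))}.

Definition positive_global_solution (R : realType) (tau G u : R -> R) : Prop :=
  global_solution tau G u /\ forall t, 0 < u t.

(* max {G x : x in [0, s]}: for 0 <= s and G continuous on [0, +oo[, the
   supremum is attained. *)
Definition running_max (R : realType) (G : R -> R) (s : R) : R :=
  sup [set G x | x in `[0, s]].

(* sup {tau t : t <= t0}; a genuine supremum as soon as tau is bounded above
   on ]-oo, t0] (the library's sup of an unbounded set is 0). *)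
Definition delay_sup (R : realType) (tau : R -> R) (t0 : R) : R :=
  sup [set tau t | t in `]-oo, t0]].

(* Main.v *)
Require Import Defs.
From HB Require Import structures.
From mathcomp Require Import all_boot all_order all_algebra.
From mathcomp Require Import all_classical all_reals all_analysis.
From mathcomp Require Import ring lra.

Import Order.TTheory GRing.Theory Num.Theory.
Import numFieldNormedType.Exports.

Local Open Scope classical_set_scope.
Local Open Scope ring_scope.

(** The solution is obtained as a limit of Euler approximations started further and
further in the past, with the nonlinearity truncated at [kappa] up to time
[t0]: the right-hand side is [F x = G (min kappa x)] for [t <= t0] and [G]
afterwards.

Sublinearity of the running maximum of [G] provides a level [B >= kappa] with
[G <= B] on [[0, B]], so that Euler's scheme keeps the range [[0, B]]. Starting
at time [t0 - N] from a constant history [s], the value at [t0] depends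
continuously on [s]; it is [0] for [s = 0], and at least [kappa] for
[s = kappa] since [F >= kappa] above [kappa]. The intermediate value theorem
yields a discrete solution worth [c] at [t0] ([euler_solution]). These
approximations are uniformly Lipschitz up to the step [1/N], and their
difference quotients near a time are uniformly close to the right-hand side
there; both properties are closed under pointwise limits, and pointwise limits
exist along an ultrafilter. This gives a Lipschitz [u] with values in [[0, B]]
that solves the truncated equation at every [t <> t0] ([limit_solution]).

The qualitative properties concern the past only, where the delay has a finite
supremum [M], and rest on the remark that
[K <= F (u (t - tau t))] forces [u - K] to decay no faster than [exp (- t)]
([decay_lower]).
- If [u >= e] at some time, then [u >= min kappa (e * exp (- M))] from then on
  until [t0] ([barrier]). A minimum below this level could only be reached
  after more than the maximal delay [M], so [u] was at least as large one delay
  before; since [F] strictly exceeds its argument below [kappa], [u] would then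
  be strictly increasing at its minimum.
- If [u] exceeded [kappa] at some time before [t0], the barrier would give
  [u t0 > c]; hence [u <= kappa], and the truncation is never felt
  ([past_le_kappa]).
- If [u] did not tend to [0] at [-oo], the barrier would bound [u] from below
  by a positive constant on the whole past. The infimum of [u] would then be
  strictly smaller than the minimum of [F] over the values beyond it, which is
  impossible for a solution that is bounded for all negative times
  ([past_no_lower_bound], [past_vanish]).
- If [u] vanished somewhere, it would vanish up to a last time before [t0];
  because the delay is positive, it would still vanish a little later
  ([past_gt0]). *)

(** * Euler's scheme with a prescribed final value *)

Section Euler.
Context (R : realType) (n : nat) (t0 kappa B c : R) (tau : R -> R)
  (f : R -> R -> R).
Hypothesis tau_pos : forall t, 0 < tau t.
Hypothesis f_range : forall t x : R, 0 <= x <= B -> 0 <= f t x <= B.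
Hypothesis f_cont : forall t, continuous (f t).
Hypothesis f0 : forall t, t <= t0 -> f t 0 = 0.
Hypothesis f_kappa : forall t x, t <= t0 -> kappa <= x -> kappa <= f t x.
Hypothesis c_rng : 0 <= c <= kappa.
Hypothesis kappa_B : kappa <= B.

Let N : R := n.+1%:R.
Let h : R := N^-1.

Let N_gt0 : 0 < N. Proof. by rewrite ltr0n. Qed.
Let h_gt0 : 0 < h. Proof. by rewrite invr_gt0. Qed.
Let h_le1 : h <= 1. Proof. by rewrite invf_le1// ler1n. Qed.
Let hN : h * N = 1. Proof. by rewrite mulVf// gt_eqF. Qed.

(** The grid starts at [t0 - N] and has step [1 / N], so that [t0] is the node
   of index [N ^ 2]. *)
Definition node (k : nat) : R := t0 - N + h * k%:R.
Definition idx (t : R) : nat := Num.truncn ((t - t0 + N) * N).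

(** The delayed value may refer to any earlier step, so the recursion carries
the whole history: [hist s k] agrees with the scheme up to index [k]. Truncation
in [idx] sends times before the grid to its first node, which amounts to the
constant history [s]. *)
Fixpoint hist (s : R) (k : nat) : nat -> R :=
  if k is k'.+1 then fun j => if (j <= k')%N then hist s k' j else
    hist s k' k' + h * (f (node k') (hist s k' (idx (node k' - tau (node k'))))
                         - hist s k' k')
  else fun _ => s.

Definition euler (s : R) (k : nat) : R := hist s k k.

Lemma le_idx : {homo idx : s t / s <= t >-> (s <= t)%N}.
Proof.
by move=> s t st; apply: le_truncn; rewrite ler_pM2r// lerD2r lerD2r.
Qed.

Lemma nodeK : cancel node idx.
Proof.
move=> k; rewrite /idx /node (_ : _ * _ = k%:R) ?natrK//.
rewrite (_ : _ * _ = (h * N) * k%:R); last by ring.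
by rewrite hN mul1r.
Qed.

Lemma idx_t0 : idx t0 = (n.+1 * n.+1)%N.
Proof. by rewrite /idx subrr add0r -natrM natrK. Qed.

Lemma node_le k : (k <= n.+1 * n.+1)%N -> node k <= t0.
Proof.
rewrite -(ler_nat R) natrM -/N => kN; rewrite /node.
have : h * k%:R <= h * (N * N) by rewrite ler_pM2l.
by rewrite mulrA hN mul1r; lra.
Qed.

Lemma lag_le k : (idx (node k - tau (node k)) <= k)%N.
Proof.
by rewrite -[leqRHS]nodeK; apply: le_idx; rewrite gerBl ltW.
Qed.

Lemma hist_euler s k j : (j <= k)%N -> hist s k j = euler s j.
Proof.
elim: k => [|k IH]; first by rewrite leqn0 => /eqP ->.
rewrite /euler leq_eqVlt => /orP[/eqP -> //|]; rewrite ltnS => jk.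
by rewrite /= jk IH.
Qed.

Lemma eulerS s k : euler s k.+1 = euler s k +
  h * (f (node k) (euler s (idx (node k - tau (node k)))) - euler s k).
Proof. by rewrite {1}/euler /= ltnn !hist_euler// lag_le. Qed.

(** As [h <= 1], each step is a convex combination of the current value and of
a value of [f], which both lie in [[0, B]]. *)
Lemma euler_range (s : R) k : 0 <= s <= B -> 0 <= euler s k <= B.
Proof.
move=> sB; elim/ltn_ind: k => -[//|k] IH; rewrite eulerS.
have /andP[v0 vB] := IH k (ltnSn _).
have /(f_range (node k)) /andP[f1 f2] :=
  IH (idx (node k - tau (node k))) (leq_ltn_trans (lag_le k) (ltnSn _)).
move: (euler s k) (f _ _) v0 vB f1 f2 => v y *.
have -> : v + h * (y - v) = (1 - h) * v + h * y by ring.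
have h1 : 0 <= 1 - h by rewrite subr_ge0.
apply/andP; split; first by rewrite addr_ge0// mulr_ge0// ltW.
have -> : B = (1 - h) * B + h * B by ring.
by apply: lerD; [rewrite ler_wpM2l|rewrite ler_pM2l].
Qed.

Lemma euler_continuous k : continuous (euler ^~ k).
Proof.
suff H : forall j, continuous (fun s => hist s k j) by exact: H.
elim: k => [|k IH] j /=; first by move=> s; exact: cvg_id.
case: (j <= k)%N; first exact: IH.
move=> s; apply: cvgD; first exact: IH.
apply: cvgM; first exact: cvg_cst.
apply: cvgB; last exact: IH.
apply: (@continuous_comp _ _ _ (fun s => hist s k _) (f _)); first exact: IH.
exact: f_cont.
Qed.

Lemma euler0 k : (k <= n.+1 * n.+1)%N -> euler 0 k = 0.
Proof.
elim/ltn_ind: k => -[//|k] IH kN; rewrite eulerS !IH ?(ltnW kN)//.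
- by rewrite f0 ?node_le ?(ltnW kN)// subrr mulr0 addr0.
- exact: (leq_ltn_trans (lag_le k) (ltnSn _)).
- exact: (leq_trans (lag_le k) (ltnW kN)).
Qed.

Lemma euler_ge_kappa k : (k <= n.+1 * n.+1)%N -> kappa <= euler kappa k.
Proof.
elim/ltn_ind: k => -[//|k] IH kN; rewrite eulerS.
have v1 := IH k (ltnSn _) (ltnW kN).
have v2 := IH _ (leq_ltn_trans (lag_le k) (ltnSn _))
  (leq_trans (lag_le k) (ltnW kN)).
have := f_kappa (node k) _ (node_le k (ltnW kN)) v2.
move: (euler kappa k) (f _ _) v1 => v y v1 y1.
have -> : v + h * (y - v) = (1 - h) * v + h * y by ring.
have h1 : 0 <= 1 - h by rewrite subr_ge0.
have -> : kappa = (1 - h) * kappa + h * kappa by ring.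
by apply: lerD; [rewrite ler_wpM2l|rewrite ler_pM2l].
Qed.

(** Shooting: as the constant history [s] runs over [[0, kappa]], the value at
[t0] runs continuously from [0] to at least [kappa]. *)
Lemma euler_shoot : exists2 s, 0 <= s <= B & euler s (idx t0) = c.
Proof.
have /andP[c0 ck] := c_rng.
have [||s] := @IVT R (euler ^~ (idx t0)) 0 kappa c (le_trans c0 ck).
- exact/continuous_subspaceT/euler_continuous.
- rewrite idx_t0 euler0//; apply/andP; split.
    by rewrite ge_min c0.
  by rewrite le_max (le_trans ck (euler_ge_kappa _ _)) ?orbT.
rewrite in_itv/= => /andP[s0 sk] <-; exists s => //.
by rewrite s0 (le_trans sk).
Qed.

Lemma euler_lipschitz (s : R) j k : 0 <= s <= B ->
  `|euler s j - euler s k| <= h * B * `|j%:R - k%:R|.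
Proof.
move=> sB; wlog jk : j k / (k <= j)%N.
  move=> H; have [|/ltnW] := leqP k j; first exact: H.
  by rewrite distrC [X in _ * X]distrC; exact: H.
rewrite -natrB// normr_nat -(subnK jk); move: (j - k)%N => i.
rewrite addnK; elim: i => [|i IH]; first by rewrite add0n subrr normr0 mulr0.
rewrite addSn eulerS -natr1 [leRHS]mulrDr mulr1.
have /andP[v0 vB] := euler_range s (i + k) sB.
have /(f_range (node (i + k))) /andP[f1 f2] :=
  euler_range s (idx (node (i + k) - tau (node (i + k)))) sB.
rewrite addrAC (le_trans (ler_normD _ _))// lerD// normrM gtr0_norm//.
rewrite ler_pM2l// ler_norml; lra.
Qed.

(** The clamping of both indices at [0] can only bring them closer. *)
Lemma idx_dist (s t : R) : `|(idx s)%:R - (idx t)%:R| <= N * `|s - t| + 1.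
Proof.
wlog st : s t / s <= t.
  move=> H; have [|/ltW] := leP s t; first exact: H.
  by rewrite distrC [X in _ * X]distrC; exact: H.
have ist := le_idx _ _ st.
rewrite distrC [X in _ * X]distrC -natrB// normr_nat natrB//.
rewrite ger0_norm ?subr_ge0//.
have [t1|t1] := leP 0 ((t - t0 + N) * N); last first.
  have it : idx t = 0%N by rewrite /idx; apply/truncn0Pn; rewrite -ltNge; lra.
  move: ist; rewrite it leqn0 => /eqP ->; rewrite subrr addr_ge0//.
  by rewrite mulr_ge0 ?subr_ge0// ltW.
have t2 : (idx t)%:R <= (t - t0 + N) * N by rewrite truncn_le.
have : (s - t0 + N) * N < (idx s).+1%:R by exact: truncnS_gt.
rewrite -natr1; lra.
Qed.

Lemma node_idx_le (t : R) : t0 - N <= t -> node (idx t) <= t.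
Proof.
move=> tN.
have t2 : (idx t)%:R <= (t - t0 + N) * N.
  rewrite truncn_le mulr_ge0 ?(ltW N_gt0)//; lra.
have : h * (idx t)%:R <= h * ((t - t0 + N) * N) by rewrite ler_pM2l.
rewrite mulrCA hN /node; lra.
Qed.

Lemma lt_node_idx (t : R) : t - h < node (idx t).
Proof.
have : (t - t0 + N) * N < (idx t).+1%:R by exact: truncnS_gt.
rewrite -(ltr_pM2l h_gt0) mulrCA hN -natr1 mulrDr /node; lra.
Qed.

(** Telescoping: the errors made on the single steps add up. *)
Lemma euler_increment (s : R) k m (D e : R) :
  (forall j, (k <= j < k + m)%N ->
   `|f (node j) (euler s (idx (node j - tau (node j)))) - euler s j - D| <= e)
   -> `|euler s (k + m) - euler s k - h * m%:R * D| <= h * m%:R * e.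
Proof.
elim: m => [|m IH] H.
  by rewrite addn0 subrr mulr0 !mul0r subrr normr0.
have /IH {}IH : forall j, (k <= j < k + m)%N ->
   `|f (node j) (euler s (idx (node j - tau (node j)))) - euler s j - D| <= e.
  by move=> j /andP[kj jm]; apply: H; rewrite kj addnS ltnW.
have := H (k + m)%N; rewrite leq_addr addnS ltnSn => /(_ isT).
rewrite eulerS -(ler_pM2l h_gt0) -{1}[h]gtr0_norm// -normrM => H1.
rewrite -natr1 [h * (_ + 1)]mulrDr mulr1 [leRHS]mulrDl.
apply: le_trans (lerD IH H1).
set X := f _ _; set v := euler s (k + m).
have -> : v + h * (X - v) - euler s k - (h * m%:R + h) * D =
  (v - euler s k - h * m%:R * D) + h * (X - v - D) by ring.
exact: ler_normD.
Qed.

(** All that the passage to the limit needs to know about the scheme. The last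
clause replaces the differential equation: it says that increments of [w] are
close to those of slope [D] wherever the discrete slopes are close to [D], and
it only involves values of [w], so that it survives pointwise convergence. The
term in [h] accounts for [s] and [s'] not being nodes. *)
Lemma euler_solution : exists w : R -> R,
  [/\ forall t, 0 <= w t <= B, w t0 = c,
   forall s t : R, `|w s - w t| <= B * (`|s - t| + h) &
   forall D e s s' : R, 0 <= e -> t0 - N <= s -> s <= s' ->
    (forall r : R, s - h <= r <= s' -> `|f r (w (r - tau r)) - w r - D| <= e) ->
    `|w s' - w s - (s' - s) * D| <= e * (s' - s) + h * (e + `|D|)].
Proof.
have [s sB sc] := euler_shoot; exists (fun t => euler s (idx t)).
have B0 : 0 <= B by have /andP[s0 /(le_trans s0)] := sB.
split => //.
- by move=> t; exact: euler_range.
- move=> r t; apply: le_trans (euler_lipschitz _ _ _ sB) _.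
  have := idx_dist r t; rewrite -(ler_pM2l h_gt0) mulrDr mulrA hN mul1r mulr1.
  by move=> H; rewrite -mulrA mulrCA; apply: ler_wpM2l.
move=> D e a b e0 aN ab H.
have iab := le_idx _ _ ab.
have H1 : `|euler s (idx b) - euler s (idx a) -
    h * ((idx b)%:R - (idx a)%:R) * D| <= h * ((idx b)%:R - (idx a)%:R) * e.
  rewrite -natrB// -{1}(subnKC iab); apply: euler_increment => j.
  rewrite subnKC// => /andP[ja jb].
  have := H (node j); rewrite nodeK; apply; apply/andP; split.
    apply: le_trans (ltW (lt_node_idx a)) _.
    by rewrite /node lerD2l ler_pM2l// ler_nat.
  apply: le_trans _ (node_idx_le _ (le_trans aN ab)).
  by rewrite /node lerD2l ler_pM2l// ler_nat ltnW.
have := node_idx_le _ aN; have := node_idx_le _ (le_trans aN ab).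
have := lt_node_idx a; have := lt_node_idx b; rewrite /node.
move: H1; rewrite mulrBr.
move: (h * (idx a)%:R) (h * (idx b)%:R) => i j H1 h1 h2 h3 h4.
set x := _ - _ - _ in H1.
have -> : euler s (idx b) - euler s (idx a) - (b - a) * D =
  x + ((j - i) - (b - a)) * D by rewrite /x; ring.
apply: le_trans (ler_normD _ _) _.
have : `|(j - i - (b - a)) * D| <= h * `|D|.
  by rewrite normrM ler_wpM2r// ler_norml; lra.
have : (j - i) * e <= (b - a + h) * e by rewrite ler_wpM2r//; lra.
lra.
Qed.
End Euler.

(** * Passage to the limit *)

Lemma ultra_bounded_cvg (R : realType) (U : set_system nat) (w : nat -> R)
    (a b : R) : UltraFilter U -> (forall n, a <= w n <= b) ->
  exists2 l, a <= l <= b & w n @[n --> U] --> l.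
Proof.
move=> UU wab.
have wU : U (w @^-1` `[a, b]%classic).
  by apply: filterS filterT => n _ /=; rewrite in_itv/=; exact: wab.
have [l [lab cl]] := @segment_compact R a b (w @ U) _ wU.
exists l; first by move: lab; rewrite /= in_itv.
move=> A Al; have [//|UA] := in_ultra_setVsetC (w @^-1` A) UU.
by have [x [/=]] := cl (~` A) A UA Al.
Qed.

Lemma is_derive_linear_approx (R : realType) (u : R -> R) (t D : R) :
  (forall e : R, 0 < e -> exists2 d : R, 0 < d & forall y, `|y - t| < d ->
    `|u y - u t - (y - t) * D| <= e * `|y - t|) ->
  is_derive t 1 u D.
Proof.
move=> H.
have cv : h^-1 *: ((u \o shift t) (h *: 1) - u t) @[h --> 0^'] --> D.
  apply/cvgrPdist_le => e e0; have [d d0 Hd] := H e e0.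
  near=> h.
  have h0 : h != 0 by near: h; exact: nbhs_dnbhs_neq.
  have hd : `|h| < d.
    near: h; apply: dnbhs0_lt; exact: d0.
  have := Hd (h + t); rewrite addrK => /(_ hd) He.
  rewrite /= -[h *: 1]/(h * 1) mulr1 -[_ *: _]/(_ * _).
  have -> : D - h^-1 * (u (h + t) - u t) =
    - (h^-1 * (u (h + t) - u t - h * D)) by field.
  rewrite normrN normrM normfV mulrC ler_pdivrMr ?normr_gt0//.
apply: DeriveDef; first by apply/cvg_ex; exists D.
exact: cvg_lim cv.
Unshelve. all: by end_near. Qed.

Section Limit.
Context (R : realType) (t0 B c : R) (tau : R -> R) (f : R -> R -> R)
  (w : nat -> R -> R).
Local Notation h n := (n.+1%:R^-1 : R).
Hypothesis tau_cont : continuous tau.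
Hypothesis w_range : forall n t, 0 <= w n t <= B.
Hypothesis w_t0 : forall n, w n t0 = c.
Hypothesis w_lip : forall n (s t : R), `|w n s - w n t| <= B * (`|s - t| + h n).
Hypothesis w_approx : forall n (D e s s' : R),
  0 <= e -> t0 - n.+1%:R <= s -> s <= s' ->
  (forall r : R, s - h n <= r <= s' ->
    `|f r (w n (r - tau r)) - w n r - D| <= e) ->
  `|w n s' - w n s - (s' - s) * D| <= e * (s' - s) + h n * (e + `|D|).

(** The equation is recovered at the times [t] such that [f] is jointly
continuous at every [(t, x)]; for the truncated nonlinearity these are all times
but [t0]. The Lipschitz estimate makes the discrete slopes near [t] uniformly
close to [f t (u (t - tau t)) - u t], although convergence is only pointwise. *)
Lemma limit_solution : exists u : R -> R,
  [/\ forall t, 0 <= u t <= B, u t0 = c,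
      forall s t : R, `|u s - u t| <= B * `|s - t| &
      forall t,
        (forall x e : R, 0 < e -> exists2 d : R, 0 < d & forall r y : R,
           `|r - t| < d -> `|y - x| < d -> `|f r y - f t x| <= e) ->
        is_derive t 1 u (f t (u (t - tau t)) - u t)].
Proof.
have [U [UU sU]] := @ultraFilterLemma nat \oo _.
have /choice[u uP] : forall t, exists l, 0 <= l <= B /\ w n t @[n --> U] --> l.
  move=> t; have [l] := ultra_bounded_cvg R U (w ^~ t) 0 B UU (w_range ^~ t).
  by exists l.
have u_cvg t : w n t @[n --> U] --> u t by have [] := uP t.
have h_cvg : h n @[n --> U] --> (0 : R).
  by move=> A /(@cvg_harmonic R A)/sU.
have B0 : 0 <= B by have /andP[x] := w_range 0 0; exact: le_trans.
exists u; split.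
- by move=> t; have [] := uP t.
- have Ec : (w ^~ t0) = fun=> c by apply/funext => n; exact: w_t0.
  have := u_cvg t0; rewrite Ec => uc.
  exact: (cvg_unique (@norm_hausdorff _ _) uc (cvg_cst _)).
- move=> s t.
  have cl : `|w n s - w n t| @[n --> U] --> `|u s - u t|.
    by apply: cvg_norm; apply: cvgB.
  have cr : B * (`|s - t| + h n) @[n --> U] --> B * (`|s - t| + 0).
    by apply: cvgM; [exact: cvg_cst|apply: cvgD => //; exact: cvg_cst].
  rewrite -[X in B * X]addr0; apply: ler_cvg_to cl cr _.
  by apply: filterS filterT.
move=> t f_cont; set x := u (t - tau t); set D := f t x - u t.
apply: is_derive_linear_approx => e e0.
have [d d0 fd] := f_cont x (e / 2) (divr_gt0 e0 (ltr0Sn R 1)).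
(* A time lag of at most [4 * a] changes the approximations by at most [d / 4]
   and [e / 4]. *)
pose a := Num.min d e / (16 * (B + 1)).
have C0 : 0 < 16 * (B + 1) by rewrite mulr_gt0// ltr_wpDl.
have a0 : 0 < a by rewrite divr_gt0// lt_min d0 e0.
have Ba : 16 * (B * a) <= Num.min d e.
  have -> : Num.min d e = a * (16 * (B + 1)) by rewrite divfK// gt_eqF.
  nra.
move: Ba; rewrite le_min => /andP[Bad Bae].
have [q q0 tauq] : exists2 q, 0 < q & forall r, `|r - t| < q ->
    `|tau r - tau t| < a.
  have /cvgrPdist_lt/(_ a a0)/nbhs_ballP[q /= q0 qP] := tau_cont t.
  exists q => // r rt; rewrite distrC; apply: qP.
  by rewrite /ball/= distrC.
pose b := Num.min a (Num.min (d / 2) (q / 2)).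
have b0 : 0 < b by rewrite !lt_min a0 !divr_gt0.
have [ba bd bq] : [/\ b <= a, b <= d / 2 & b <= q / 2].
  by rewrite /b !ge_min !lexx !orbT.
clearbody b a.
(* [u] is strictly differentiable at [t]: both end points of the increment may
   vary. *)
have key (s s' : R) : s <= s' -> `|s - t| < b -> `|s' - t| < b ->
    `|u s' - u s - (s' - s) * D| <= e * (s' - s).
  move=> ss' sb s'b.
  have cl : `|w n s' - w n s - (s' - s) * D| @[n --> U] -->
      `|u s' - u s - (s' - s) * D|.
    apply: cvg_norm; apply: cvgB; last exact: cvg_cst.
    exact: cvgB.
  have cr : e * (s' - s) + h n * (e + `|D|) @[n --> U] -->
      e * (s' - s) + 0 * (e + `|D|).
    apply: cvgD; first exact: cvg_cst.
    by apply: cvgM => //; exact: cvg_cst.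
  rewrite -[leRHS]addr0 -[X in _ <= _ + X](mul0r (e + `|D|)).
  apply: ler_cvg_to cl cr _.
  have hb : \forall n \near U, h n < b.
    by have /cvgrPdist_lt/(_ b b0) := h_cvg; apply: filterS => n;
       rewrite sub0r normrN ger0_norm.
  have nt : \forall n \near U, t0 - n.+1%:R <= t - b.
    apply: sU; near=> n.
    have : t0 - t + b <= n%:R by near: n; exact: nbhs_infty_ger.
    rewrite -natr1; lra.
  have w1 : \forall n \near U, `|u t - w n t| < e / 8.
    by have /cvgrPdist_lt := u_cvg t; apply; rewrite divr_gt0.
  have w2 : \forall n \near U, `|x - w n (t - tau t)| < d / 4.
    by have /cvgrPdist_lt := u_cvg (t - tau t); apply; rewrite divr_gt0.
  have : U (fun n => [/\ h n < b, t0 - n.+1%:R <= t - b,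
      `|u t - w n t| < e / 8 & `|x - w n (t - tau t)| < d / 4]).
    by apply: filterS (filterI (filterI hb nt) (filterI w1 w2)) => n [[]] ? ? [].
  apply: filterS => m; move: (m : nat) => {m} n [hnb ntb wt wx].
  have : 0 < h n by rewrite invr_gt0.
  have := w_lip n; have := w_approx n.
  move: (h n) hnb => hn hnb appr lip h0.
  move: sb s'b; rewrite !ltr_distl => /andP[sb1 sb2] /andP[s'b1 s'b2].
  apply: appr => //; [exact: ltW|lra|].
  move=> r /andP[r1 r2].
  have rt : `|r - t| < 2 * b by rewrite ltr_distl; lra.
  have wr : `|w n r - u t| <= e / 2.
    have -> : w n r - u t = (w n r - w n t) - (u t - w n t) by ring.
    apply: le_trans (ler_normB _ _) _.
    have : B * (`|r - t| + hn) <= B * (3 * a) by rewrite ler_wpM2l//; lra.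
    have := lip r t; lra.
  have taur : `|tau r - tau t| < a by apply: tauq; lra.
  have xr : `|w n (r - tau r) - x| < d.
    have -> : w n (r - tau r) - x =
      (w n (r - tau r) - w n (t - tau t)) - (x - w n (t - tau t)) by ring.
    apply: le_lt_trans (ler_normB _ _) _.
    have : B * (`|r - tau r - (t - tau t)| + hn) <= B * (4 * a).
      rewrite ler_wpM2l//.
      have : `|r - tau r - (t - tau t)| <= `|r - t| + `|tau r - tau t|.
        have -> : r - tau r - (t - tau t) = (r - t) - (tau r - tau t) by ring.
        exact: ler_normB.
      lra.
    have := lip (r - tau r) (t - tau t); lra.
  have := fd r (w n (r - tau r)) _ xr; rewrite (lt_le_trans rt) => [/(_ isT)|]; last lra.
  have -> : f r (w n (r - tau r)) - w n r - D =
    (f r (w n (r - tau r)) - f t x) - (w n r - u t) by rewrite /D; ring.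
  move=> H; apply: le_trans (ler_normB _ _) _; lra.
exists b => // y yb; have tb : `|t - t| < b by rewrite subrr normr0.
have [ty|/ltW ty] := leP t y.
  by rewrite [`|y - t|]ger0_norm ?subr_ge0//; exact: key.
rewrite [`|y - t|]ler0_norm ?subr_le0// opprB.
have -> : u y - u t - (y - t) * D = - (u t - u y - (t - y) * D) by ring.
by rewrite normrN; exact: key.
Unshelve. all: by end_near. Qed.
End Limit.

(** * Comparison with exponential decay *)

(** [expR t * (u t - K)] has derivative [expR t * (v t - K) >= 0]. *)
Lemma decay_lower (R : realType) (u v : R -> R) (K a b : R) :
  a <= b -> continuous u ->
  (forall t, a < t -> t < b -> is_derive t 1 u (v t - u t)) ->
  (forall t, a < t -> t < b -> K <= v t) ->
  (u a - K) * expR (a - b) <= u b - K.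
Proof.
rewrite le_eqVlt => /predU1P[<- _ _ _|ab cu du Kv].
  by rewrite subrr expR0 mulr1.
pose phi t := expR t * (u t - K).
have phi_der t : t \in `]a, b[ -> is_derive t 1 phi (expR t * (v t - K)).
  rewrite in_itv/= => /andP[at_ tb]; have := du t at_ tb => dut.
  have -> : phi = expR * (u - cst K) by [].
  apply: is_derive_eq; rewrite /GRing.scale/= (_ : (u - cst K) t = u t - K)//; ring.
have phi_cont : {within `[a, b], continuous phi}.
  apply: continuous_subspaceT => x; apply: cvgM; first exact: continuous_expR.
  by apply: cvgB; [exact: cu|exact: cvg_cst].
have [d] := MVT ab phi_der phi_cont.
rewrite in_itv/= => /andP[ad db] Ed.
have : phi a <= phi b.
  rewrite -subr_ge0 Ed; apply: mulr_ge0; last by rewrite subr_ge0 ltW.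
  by rewrite mulr_ge0 ?expR_ge0// subr_ge0 Kv.
move=> phi_ab; rewrite -(ler_pM2l (expR_gt0 b)); apply: le_trans phi_ab.
by rewrite mulrCA -expRD subrKC mulrC.
Qed.

Lemma left_smaller (R : realType) (u : R -> R) (t D a : R) :
  is_derive t 1 u D -> 0 < D -> a < t -> exists2 s, a < s < t & u s < u t.
Proof.
move=> [dv Dv] D0 at_.
have cv : h^-1 *: ((u \o shift t) (h *: 1) - u t) @[h --> 0^'] --> D.
  by rewrite -Dv.
have near0 : \forall h \near 0^'-, 0 < h^-1 *: ((u \o shift t) (h *: 1) - u t).
  have /cvgrPdist_lt/(_ D D0) := cv.
  rewrite !near_withinE; apply: filterS => h + h0.
  rewrite lt_eqF// => /(_ isT).
  by rewrite ltr_distl; lra.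
have : \forall h \near 0^'-, a < h + t < t /\ u (h + t) < u t.
  near=> h.
  have h0 : h < 0 by near: h; exact: nbhs_left_lt.
  have ha : a - t < h by near: h; apply: nbhs_left_gt; rewrite subr_lt0.
  have : 0 < h^-1 *: ((u \o shift t) (h *: 1) - u t) by near: h.
  rewrite /= -[h *: 1]/(h * 1) mulr1 -[_ *: _]/(_ * _).
  rewrite nmulr_rgt0 ?invr_lt0// subr_lt0 => uh; split => //; lra.
move=> /filter_ex[h [hat uh]]; by exists (h + t).
Unshelve. all: by end_near. Qed.

Lemma decay_upper (R : realType) (u v : R -> R) (K a b : R) :
  a <= b -> continuous u ->
  (forall t, a < t -> t < b -> is_derive t 1 u (v t - u t)) ->
  (forall t, a < t -> t < b -> v t <= K) ->
  u b - K <= (u a - K) * expR (a - b).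
Proof.
move=> ab cu du vK.
have := @decay_lower R (- u) (- v) (- K) a b ab.
rewrite /= -[(- u) a]/(- u a) -[(- u) b]/(- u b) => H.
rewrite -lerN2 -mulNr [- (u a - K)]opprD [- (u b - K)]opprD.
apply: H; first by move=> x; apply: cvgN; exact: cu.
- move=> t at_ tb; have := du t at_ tb => dut.
  by apply: is_derive_eq; rewrite opprD.
- by move=> t at_ tb; rewrite lerN2 vK.
Qed.

(** * Solutions on the past half-line *)

Section Past.
Context (R : realType) (t0 kappa M B c : R) (tau F u : R -> R).
Hypothesis tau_pos : forall t, 0 < tau t.
Hypothesis tau_cont : continuous tau.
Hypothesis tau_le : forall t, t <= t0 -> tau t <= M.
Hypothesis F_cont : continuous F.
Hypothesis F_ge0 : forall x, 0 <= F x.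
Hypothesis F0 : F 0 = 0.
(* Equivalently, [x < F x] for [0 < x < kappa] and [kappa <= F x] beyond; this
   is the form in which minima are compared with values one delay earlier. *)
Hypothesis F_gt : forall m x, 0 < m -> m < kappa -> m <= x -> m < F x.
Hypothesis u_cont : continuous u.
Hypothesis u_range : forall t, 0 <= u t <= B.
Hypothesis u_sol : forall t, t < t0 -> is_derive t 1 u (F (u (t - tau t)) - u t).
Hypothesis u_t0 : u t0 = c.
Hypothesis kappa_gt0 : 0 < kappa.
Hypothesis c_gt0 : 0 < c.
Hypothesis c_le : c <= kappa * expR (- M).

Let M_gt0 : 0 < M. Proof. exact: lt_le_trans (tau_pos t0) (tau_le t0 _). Qed.

Let c_lt : c < kappa.
Proof.
apply: le_lt_trans c_le _; rewrite gtr_pMr// -[ltRHS]expR0 ltr_expR.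
by rewrite oppr_lt0.
Qed.

Let u_ge0 t : 0 <= u t. Proof. by have /andP[] := u_range t. Qed.

Lemma u_decay K s t : s <= t -> t <= t0 ->
  (forall r, s < r -> r < t -> K <= F (u (r - tau r))) ->
  (u s - K) * expR (s - t) <= u t - K.
Proof.
move=> st tt0; apply: decay_lower => // r sr rt.
by apply: u_sol; apply: lt_le_trans tt0.
Qed.

Lemma u_decay0 s t : s <= t -> t <= t0 -> u s * expR (s - t) <= u t.
Proof.
by move=> st tt0; have := u_decay 0 s t st tt0 (fun _ _ _ => F_ge0 _); rewrite !subr0.
Qed.

(** The minimum of [u] over [[s, t]] cannot lie below the barrier: by
exponential decay it is reached after [s + M], where the delayed value is at
least as large, so [u] is strictly increasing there. The time [t0] is left out
because the equation is only known to hold before it. *)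
Lemma barrier_lt e s t : 0 < e -> e <= u s -> s <= t -> t < t0 ->
  Num.min kappa (e * expR (- M)) <= u t.
Proof.
move=> e0 es st tt0; rewrite leNgt; apply/negP => ut.
have [t1 t1st t1min] := EVT_min st (continuous_subspaceT u_cont).
move: t1st; rewrite in_itv/= => /andP[st1 t1t].
have : u t1 < Num.min kappa (e * expR (- M)).
  by apply: le_lt_trans ut; apply: t1min; rewrite in_itv/= st lexx.
rewrite lt_min => /andP[t1k t1e].
have t1t0 : t1 <= t0 by rewrite (le_trans t1t)// ltW.
have dec := u_decay0 s t1 st1 t1t0.
have ut1 : 0 < u t1.
  by apply: lt_le_trans dec; rewrite mulr_gt0 ?expR_gt0// (lt_le_trans e0).
have lag : M < t1 - s.
  have : e * expR (s - t1) < e * expR (- M).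
    apply: le_lt_trans t1e; apply: le_trans dec.
    by rewrite ler_pM2r ?expR_gt0.
  by rewrite ltr_pM2l// ltr_expR; lra.
have := tau_le t1 t1t0; have := tau_pos t1 => tau1 tau2.
have min1 : u t1 <= u (t1 - tau t1).
  apply: t1min; rewrite in_itv/=; lra.
have D0 : 0 < F (u (t1 - tau t1)) - u t1 by rewrite subr_gt0 F_gt.
have st1' : s < t1 by lra.
have [r] := left_smaller R u t1 _ s (u_sol t1 (le_lt_trans t1t tt0)) D0 st1'.
move=> /andP[sr rt1]; rewrite ltNge t1min// in_itv/=; lra.
Qed.

Lemma barrier e s t : 0 < e -> e <= u s -> s <= t -> t <= t0 ->
  Num.min kappa (e * expR (- M)) <= u t.
Proof.
move=> e0 es; rewrite le_eqVlt => /predU1P[<- _|st].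
  apply: le_trans es; rewrite ge_min; apply/orP; right.
  by rewrite ger_pMr// -[leRHS]expR0 ler_expR oppr_le0 ltW.
move=> tt0; rewrite leNgt; apply/negP => ut.
have : \forall r \near t^'-, s < r < t /\ u r < Num.min kappa (e * expR (- M)).
  near=> r; split.
    by apply/andP; split; near: r; [exact: nbhs_left_gt|exact: nbhs_left_lt].
  by near: r; apply: cvgr_lt ut; exact/cvg_at_left_filter/u_cont.
move=> /filter_ex[r [/andP[sr rt]]].
by rewrite ltNge (barrier_lt e s r e0 es (ltW sr) (lt_le_trans rt tt0)).
Unshelve. all: by end_near. Qed.

(** The barrier issued from a value above [kappa] lies strictly above [c]: this
is what the factor [expR (- M)] in the bound on [c] is for. *)
Lemma past_le_kappa t : t <= t0 -> u t <= kappa.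
Proof.
move=> tt0; rewrite leNgt; apply/negP => kut.
have ut := lt_trans kappa_gt0 kut.
have := barrier (u t) t t0 ut (lexx _) tt0 (lexx _).
rewrite u_t0 leNgt lt_min c_lt/= (le_lt_trans c_le)//.
by rewrite ltr_pM2r ?expR_gt0.
Qed.

(** Let [i] be the infimum of [u] over the past, which is less than [kappa]
because [u t0 = c]. The minimum [F z] of [F] over [[i, B]] is greater than [i],
so [u] goes below [F z] at some [t]. Going back in time from [t], the distance
of [u] below [F z] grows at least exponentially, and [u] becomes negative. *)
Lemma past_no_lower_bound m : 0 < m -> ~ (forall t, t <= t0 -> m <= u t).
Proof.
move=> m0 mu; pose E := [set u t | t in `]-oo, t0]].
have hE : has_inf E.
  split; first by exists (u t0), t0 => //=; rewrite in_itv/=.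
  by exists 0 => _ [t _ <-].
have mE : m <= inf E.
  by apply: lb_le_inf; [case: hE|move=> _ [t + <-]; rewrite /= in_itv/=; exact: mu].
have Eu t : t <= t0 -> inf E <= u t.
  by move=> tt0; apply: ge_inf; [case: hE|exists t => //=; rewrite in_itv].
have i0 : 0 < inf E := lt_le_trans m0 mE.
have ik : inf E < kappa by apply: le_lt_trans (Eu t0 _) _ => //; rewrite u_t0.
have iB : inf E <= B by apply: le_trans (Eu t0 _) _ => //; have /andP[] := u_range t0.
have [z] := EVT_min iB (continuous_subspaceT F_cont).
rewrite in_itv/= => /andP[iz zB] zmin.
have muE : 0 < F z - inf E by rewrite subr_gt0 F_gt.
have [_ [t + <-]] := inf_adherent muE hE.
rewrite /= in_itv/= => tt0; rewrite subrKC => utz.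
(* Going back by [x] multiplies the gap [F z - u t] by [expR x >= 1 + x], hence
   makes it larger than [F z]. *)
pose x := F z / (F z - u t).
have d0 : 0 < F z - u t by rewrite subr_gt0.
have x0 : 0 <= x by rewrite divr_ge0// ltW.
have xt : t - x <= t by rewrite gerBl.
have := u_decay (F z) (t - x) t xt tt0.
have -> : t - x - t = - x by ring.
rewrite expRN => H.
have {}H : (u (t - x) - F z) / expR x <= u t - F z.
  apply: H => r r1 r2.
  apply: zmin; rewrite in_itv/= Eu/=; last first.
    by rewrite (le_trans _ tt0)// (le_trans _ (ltW r2))// gerBl ltW.
  by have /andP[] := u_range (r - tau r).
move: H; rewrite ler_pdivrMr ?expR_gt0// => H.
have ex : (F z - u t) * (1 + x) <= (F z - u t) * expR x.
  by rewrite ler_pM2l// expR_ge1Dx.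
have : (F z - u t) * x = F z by rewrite /x mulrC divfK// gt_eqF.
have := u_ge0 (t - x); nra.
Qed.

Lemma past_vanish : u t @[t --> -oo] --> 0.
Proof.
apply/cvgrPdist_le => e e0.
suff [A HA] : exists A, forall t, t <= A -> u t < e.
  near=> t; rewrite sub0r normrN ger0_norm//; apply/ltW/HA.
  by near: t; apply: nbhs_ninfty_le; exact: num_real.
apply: contrapT => nA.
have ue A : exists2 s, s <= A & e <= u s.
  apply: contrapT => nS; apply: nA; exists A => t tA.
  by rewrite ltNge; apply/negP => et; apply: nS; exists t.
apply: (past_no_lower_bound (Num.min kappa (e * expR (- M)))).
  by rewrite lt_min kappa_gt0 mulr_gt0// expR_gt0.
by move=> t tt0; have [s st es] := ue t; exact: barrier es st tt0.
Unshelve. all: by end_near. Qed.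

(** Zeros propagate backwards by exponential decay, and forwards by less than
the delay since [u' = - u] as long as the delayed values vanish; so there is no
last zero before [t0]. *)
Lemma past_gt0 t : t <= t0 -> 0 < u t.
Proof.
move=> tt0; rewrite lt_neqAle u_ge0 andbT eq_sym; apply/eqP => ut.
pose S := [set s | s <= t0 /\ u s = 0].
have hS : has_sup S by split; [exists t|exists t0 => s []].
have zero_below s r : S s -> r <= s -> u r = 0.
  move=> [st0 us] rs; apply/eqP; rewrite eq_le u_ge0 andbT.
  have := u_decay0 r s rs st0; rewrite us pmulr_lle0//; exact: expR_gt0.
have St0 : sup S <= t0 by apply: ge_sup; [case: hS|move=> s []].
have zero_lt r : r < sup S -> u r = 0.
  rewrite -subr_gt0 => r0; have [s Ss] := sup_adherent r0 hS.
  by rewrite subKr => /ltW; exact: zero_below.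
have uS : u (sup S) = 0.
  apply/eqP; rewrite eq_le u_ge0 andbT leNgt; apply/negP => uS.
  have : \forall r \near (sup S)^'-, r < sup S /\ 0 < u r.
    near=> r; split; first by near: r; exact: nbhs_left_lt.
    by near: r; apply: cvgr_gt uS; exact/cvg_at_left_filter/u_cont.
  by move=> /filter_ex[r [/zero_lt ->]]; rewrite ltxx.
have Slt : sup S < t0.
  rewrite lt_neqAle St0 andbT; apply/eqP => St.
  by move: c_gt0; rewrite -u_t0 -St uS ltxx.
have lagS : sup S - tau (sup S) < sup S by rewrite gtrBl.
have lag_cvg : (r - tau r) @[r --> sup S] --> sup S - tau (sup S).
  by apply: cvgB; [exact: cvg_id|exact: tau_cont].
have /cvgr_lt/(_ _ lagS) := lag_cvg.
move=> /nbhs_ballP[d /= d0 dP].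
pose b := Num.min t0 (sup S + d / 2).
have Sb : sup S < b by rewrite lt_min Slt/= ltrDl divr_gt0.
have bt0 : b <= t0 by rewrite ge_min lexx.
have bd : b <= sup S + d / 2 by rewrite ge_min lexx orbT.
suff Bb : S b by have := sup_upper_bound hS Bb; rewrite leNgt Sb.
split => //; apply/eqP; rewrite eq_le u_ge0 andbT.
have := @decay_upper R u (fun r => F (u (r - tau r))) 0 (sup S) b (ltW Sb) u_cont.
rewrite uS !subr0 mul0r; apply.
  by move=> r _ rb; apply: u_sol; exact: lt_le_trans bt0.
move=> r Sr rb; rewrite zero_lt ?F0//.
by apply: dP; rewrite /ball/= ltr_distlC; lra.
Unshelve. all: by end_near. Qed.
End Past.

(** * Regularity and the data of the problem *)

Lemma abs_continuous_lipschitz (R : realType) (u : R -> R) (B a b : R) :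
  (forall s t : R, `|u s - u t| <= B * `|s - t|) -> abs_continuous_on a b u.
Proof.
move=> uB e e0; have C0 : 0 < `|B| + 1 by rewrite ltr_wpDl.
exists (e / (`|B| + 1)); first exact: divr_gt0.
move=> n x y xy _; rewrite ltr_pdivlMr// => /(le_lt_trans _); apply.
rewrite mulr_suml; apply: ler_sum => i _.
have [_ [xyi _]] := xy i.
apply: le_trans (uB _ _) _; rewrite ger0_norm ?subr_ge0// mulrC.
by rewrite ler_wpM2l ?subr_ge0// (le_trans (ler_norm _))// lerDl.
Qed.

Lemma continuous_extend0 (R : realType) (G : R -> R) :
  {within `[0, +oo[, continuous G} -> continuous (fun x : R => G (Num.max 0 x)).
Proof.
move=> /subspace_continuousP Gc x.
have m0 : `[0, +oo[%classic (Num.max 0 x) by rewrite /= in_itv/= le_max lexx.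
have mc : {for x, continuous (cst (0 : R) \max id)}.
  by apply: continuous_max; [exact: cvg_cst|exact: cvg_id].
apply: (cvg_comp (fun y : R => Num.max 0 y) G) (Gc _ m0) => V.
move=> /mc Vm; rewrite -[_ V]/(nbhs x (fun y : R => V (Num.max 0 y))).
move: Vm; rewrite -[X in X -> _]/(nbhs x (fun y : R => `[0, +oo[%classic
  (Num.max 0 y) -> V (Num.max 0 y))); apply: filterS => y; apply.
by rewrite /= in_itv/= le_max lexx.
Qed.

(** The upper limit bounds [tau] near [-oo] and continuity on the remaining
compact interval, so [delay_sup] is a genuine supremum. *)
Lemma delay_le_sup (R : realType) (tau : R -> R) (t0 : R) :
  continuous tau ->
  (limf_esup (fun t => (tau t)%:E) (ninfty_nbhs R) < +oo)%E ->
  forall t, t <= t0 -> tau t <= delay_sup tau t0.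
Proof.
move=> tc; rewrite limf_esupE => /ereal_inf_lt.
move=> [_ [V [A [_ AV]] <-]] Voo t tt0.
apply: ub_le_sup; last by exists t => //=; rewrite in_itv.
pose C := fine (ereal_sup [set (tau t)%:E | t in V]).
have HC r : r < A -> tau r <= C.
  move=> /AV Vr.
  have : ((tau r)%:E <= ereal_sup [set (tau t)%:E | t in V])%E.
    by apply: ereal_sup_ubound; exists r.
  by move: Voo; rewrite /C; case: (ereal_sup _) => //= z _; rewrite lee_fin.
have [At|tA] := leP (A - 1) t0; last first.
  by exists C => _ [r + <-]; rewrite /= in_itv/= => rt0; apply: HC; lra.
have [z _ zmax] := EVT_max At (continuous_subspaceT tc).
exists (Num.max C (tau z)) => _ [r + <-]; rewrite /= in_itv/= => rt0.
rewrite le_max; have [rA|Ar] := ltP r (A - 1).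
  by rewrite HC//; lra.
by rewrite zmax ?orbT// in_itv/= Ar.
Qed.

Lemma running_max_ge (R : realType) (G : R -> R) (x s : R) :
  {within `[0, +oo[, continuous G} -> 0 <= x <= s -> G x <= running_max G s.
Proof.
move=> Gc /andP[x0 xs]; have s0 := le_trans x0 xs.
have Gs : {within `[0, s], continuous G}.
  apply: continuous_subspaceW Gc => y /=; rewrite !in_itv/= => /andP[-> _] //.
have [z _ zmax] := EVT_max s0 Gs.
apply: ub_le_sup; last by exists x => //=; rewrite in_itv/= x0.
by exists (G z) => _ [y ys <-]; exact: zmax.
Qed.

(** By sublinearity, [running_max G B <= B] for all large [B]. *)
Lemma invariant_bound (R : realType) (G : R -> R) (kappa : R) :
  {within `[0, +oo[, continuous G} ->
  running_max G s / s @[s --> +oo] --> 0 ->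
  exists2 B, kappa <= B & forall x : R, 0 <= x <= B -> G x <= B.
Proof.
move=> Gc /cvgrPdist_lt/(_ 1 ltr01) q0.
have : \forall s \near +oo, kappa <= s /\ (0 < s /\ running_max G s <= s).
  near=> s; have s0 : 0 < s by near: s; apply: nbhs_pinfty_gt; exact: num_real.
  split; first by near: s; apply: nbhs_pinfty_ge; exact: num_real.
  split => //; have : `|0 - running_max G s / s| < 1 by near: s.
  rewrite sub0r normrN => /(le_lt_trans (ler_norm _)).
  by rewrite ltr_pdivrMr// mul1r => /ltW.
move=> /filter_ex[B [kB [B0 GB]]]; exists B => // x xB.
exact: le_trans (running_max_ge R G x B Gc xB) GB.
Unshelve. all: by end_near. Qed.

Lemma ae_except_one_point (R : realType) (t0 : R) (P : R -> Prop) :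
  (forall t, t != t0 -> P t) -> {ae @lebesgue_measure R, forall t, P t}.
Proof.
move=> HP; exists [set t0]; split => //; first exact: lebesgue_measure_set1.
by move=> t /= nP; apply: contrapT => /eqP/HP.
Qed.

(** * Existence of the solution *)

Theorem theorem6p2 (R : realType) (tau : R -> R)
  (tau_pos : forall t, 0 < tau t)
  (tau_cont : continuous tau)
  (tau_limsup : (limf_esup (fun t => (tau t)%:E) (ninfty_nbhs R) < +oo)%E)
  (kappa : R) (kappa_pos : 0 < kappa)
  (G : R -> R)
  (G_ge0 : forall s, 0 <= s -> 0 <= G s)
  (G_cont : {within `[0, +oo[, continuous G})
  (G0 : G 0 = 0)
  (G_gt : forall s, 0 < s -> s < kappa -> s < G s)
  (q0_lim : running_max G s / s @[s --> +oo] --> 0)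
  (t0 c : R) (c_pos : 0 < c)
  (c_le : c <= kappa * expR (- delay_sup tau t0)) :
  exists u : R -> R,
    [/\ positive_global_solution tau G u,
        u t0 = c,
        (forall t, t <= t0 -> u t <= kappa) &
        u t @[t --> -oo] --> 0].
Proof.
have tau_le := @delay_le_sup R tau t0 tau_cont tau_limsup.
have [B kB GB] := invariant_bound R G kappa G_cont q0_lim.
(* Extending [G] by [G 0] to the left of [0] makes it continuous everywhere. *)
pose g x := G (Num.max 0 x).
have g_cont : continuous g by exact: continuous_extend0.
have gE x : 0 <= x -> g x = G x by move=> x0; rewrite /g max_r.
have g_ge0 x : 0 <= g x by rewrite G_ge0// le_max lexx.
pose F x := g (Num.min kappa x).
have F_cont : continuous F.
  move=> x; have mc : {for x, continuous (cst kappa \min id)}.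
    by apply: continuous_min; [exact: cvg_cst|exact: cvg_id].
  exact: (continuous_comp mc (g_cont _)).
have F0 : F 0 = 0 by rewrite /F min_r ?ltW// gE.
have G_kappa : kappa <= G kappa.
  rewrite leNgt; apply/negP => Gk.
  (* Otherwise [g x < x] just to the left of [kappa]. *)
  have gk : g kappa < kappa by rewrite gE ?ltW.
  have : \forall x \near kappa^'-, (0 < x < kappa) /\ g x < x.
    near=> x; split.
      by apply/andP; split; near: x; [exact: nbhs_left_gt|exact: nbhs_left_lt].
    have : g x < (kappa + g kappa) / 2.
      near: x; apply: (cvgr_lt (g kappa)); last lra.
      exact/cvg_at_left_filter/g_cont.
    move=> /lt_trans; apply; near: x; apply: nbhs_left_gt; lra.
  move=> /filter_ex[x [/andP[x0 xk]]].
  by rewrite gE ?ltW// ltNge ltW// G_gt.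
have F_gt m x : 0 < m -> m < kappa -> m <= x -> m < F x.
  move=> m0 mk mx; rewrite /F; have [xk|kx] := ltP x kappa.
    rewrite gE ?(le_trans (ltW m0))//.
    by rewrite (le_lt_trans mx)// G_gt// (lt_le_trans m0).
  by rewrite gE ?ltW// (lt_le_trans mk).
pose f t x := if t <= t0 then F x else g x.
have c_lt : c <= kappa.
  apply: le_trans c_le _; rewrite ger_pMr// -[leRHS]expR0 ler_expR oppr_le0.
  exact: le_trans (ltW (tau_pos t0)) (tau_le t0 (lexx _)).
have f_range (t x : R) : 0 <= x <= B -> 0 <= f t x <= B.
  have gB y : 0 <= y <= B -> 0 <= g y <= B.
    by move=> yB; rewrite g_ge0/= gE ?GB//; case/andP: yB.
  move=> /andP[x0 xB]; rewrite /f /F; case: ifP => _; apply: gB.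
    by rewrite le_min (ltW kappa_pos) x0 ge_min kB.
  by rewrite x0.
have f_cont t : continuous (f t).
  by rewrite /f; case: (t <= t0); [exact: F_cont|exact: g_cont].
have f_zero t : t <= t0 -> f t 0 = 0 by rewrite /f => ->.
have f_kappa (t x : R) : t <= t0 -> kappa <= x -> kappa <= f t x.
  by rewrite /f => -> kx; rewrite /F min_l// gE// ltW.
have c_rng : 0 <= c <= kappa by rewrite ltW.
have /choice[w wP] := fun n => euler_solution R n t0 kappa B c tau f tau_pos
  f_range f_cont f_zero f_kappa c_rng kB.
have [u [u_range ut0 u_lip u_sol]] := limit_solution R t0 B c tau f w tau_cont
  (fun n => let: And4 h _ _ _ := wP n in h)
  (fun n => let: And4 _ h _ _ := wP n in h)
  (fun n => let: And4 _ _ h _ := wP n in h)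
  (fun n => let: And4 _ _ _ h := wP n in h).
have u_cont : continuous u.
  move=> x; apply/cvgrPdist_lt => e e0.
  have C0 : 0 < `|B| + 1 by rewrite ltr_wpDl.
  near=> y; apply: le_lt_trans (u_lip _ _) _.
  apply: (@le_lt_trans _ _ ((`|B| + 1) * `|x - y|)).
    by rewrite ler_wpM2r// (le_trans (ler_norm _))// lerDl.
  rewrite mulrC -ltr_pdivlMr//; near: y.
  by apply: cvgr_dist_lt; [exact: cvg_id|exact: divr_gt0].
(* Near a time other than [t0] the right-hand side does not depend on time. *)
have u_past t : t < t0 -> is_derive t 1 u (F (u (t - tau t)) - u t).
  move=> tt0; have <- : f t (u (t - tau t)) = F (u (t - tau t)).
    by rewrite /f ltW.
  apply: u_sol => x e e0.
  have /cvgrPdist_lt/(_ e e0)/nbhs_ballP[d /= d0 dP] := F_cont x.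
  exists (Num.min d (t0 - t)); first by rewrite lt_min d0 subr_gt0.
  move=> r y; rewrite !lt_min => /andP[_ rt] /andP[yx _].
  rewrite /f ltW// (_ : r <= t0); last by move: rt; rewrite ltr_distl; lra.
  by rewrite distrC ltW//; apply: dP; rewrite /ball/= distrC.
have u_future t : t0 < t -> is_derive t 1 u (g (u (t - tau t)) - u t).
  move=> tt0; have <- : f t (u (t - tau t)) = g (u (t - tau t)).
    by rewrite /f leNgt tt0.
  apply: u_sol => x e e0.
  have /cvgrPdist_lt/(_ e e0)/nbhs_ballP[d /= d0 dP] := g_cont x.
  exists (Num.min d (t - t0)); first by rewrite lt_min d0 subr_gt0.
  move=> r y; rewrite !lt_min => /andP[_ rt] /andP[yx _].
  rewrite /f [t <= _]leNgt tt0 [r <= _]leNgt (_ : t0 < r)/=; last first.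
    by move: rt; rewrite ltr_distl; lra.
  by rewrite distrC ltW//; apply: dP; rewrite /ball/= distrC.
have F_ge0 x : 0 <= F x by exact: g_ge0.
pose M := delay_sup tau t0.
have u_kappa := past_le_kappa R t0 kappa M c tau F u tau_pos tau_le F_ge0 F_gt
  u_cont u_past ut0 kappa_pos c_le.
have u_gt0 t : 0 < u t.
  have [tt0|tt0] := leP t t0.
    exact: (past_gt0 R t0 B c tau F u tau_pos tau_cont F_ge0 F0 u_cont u_range
      u_past ut0 c_pos t tt0).
  have := @decay_lower R u (fun r => g (u (r - tau r))) 0 t0 t (ltW tt0) u_cont.
  rewrite !subr0 ut0 => dec; apply: (@lt_le_trans _ _ (c * expR (t0 - t))).
    by rewrite mulr_gt0// expR_gt0.
  by apply: dec => // r t0r _; exact: u_future.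
exists u; split; [|exact: ut0|exact: u_kappa|]; last first.
  exact: (past_vanish R t0 kappa M B c tau F u tau_pos tau_le F_cont F_ge0 F_gt
    u_cont u_range u_past ut0 kappa_pos c_le).
split => //; split.
  by move=> a b _; exact: (abs_continuous_lipschitz R u B a b u_lip).
apply: (ae_except_one_point R t0) => t; rewrite addrC neq_lt => /orP[tt0|tt0].
  rewrite -gE ?ltW//; have := u_past t tt0; rewrite /F min_r//.
  by apply: u_kappa; rewrite (le_trans _ (ltW tt0))// gerBl ltW.
by rewrite -gE ?ltW//; exact: u_future.
Unshelve. all: by end_near. Qed.
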